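(* Every maximal commutative subalgebra $\mathcal{M}$ of $\mathcal{T}_{n}\otimes \mathcal{O}_{\sigma,\tau}$ is either (i) $\mathcal{F}_{A,B}$ for some $A,B\in\mathcal{O}_{\sigma,\tau}$ with at least one of them invertible, or (ii) the algebra $\mathcal{B}\otimes \mathcal{O}_{\sigma,\tau}$ (which coincides with $\mathcal{F}_{A,B}$ for any pair of linearly independent nilpotent matrices $A,B\in\mathcal{R}$). Conversely, every algebra of these two types is a maximal commutative subalgebra of $\mathcal{T}_{n}\otimes \mathcal{O}_{\sigma,\tau}$.
   Context: Fix a positive integer $n$ and positive integers $\sigma,\tau$ with $|\sigma-\tau|\le 1$, and put $d=\sigma+\tau$. The Schur algebra $\mathcal{O}_{\sigma,\tau}$ is the (commutative) algebra of all $d\times d$ complex matrices of the form $$\begin{pmatrix} \lambda I_\sigma & X \\ 0 & \lambda I_\tau \end{pmatrix},\qquad \lambda\in\mathbb{C},\ X \text{ a complex } \sigma\times\tau \text{ matrix}.$$ Its radical $\mathcal{R}$ is the set of those matrices in $\mathcal{O}_{\sigma,\tau}$ with $\lambda=0$. $\mathcal{T}_n\otimes\mathcal{O}_{\sigma,\tau}$ denotes the linear space of all $n\times n$ block Toeplitz matrices $\mathbf{T}=(T_{p-q})_{p,q=0}^{n-1}$ with blocks $T_j\in\mathcal{O}_{\sigma,\tau}$ for $j=1-n,\dots,n-1$. This space is in general not closed under multiplication. A commutative subalgebra of $\mathcal{T}_n\otimes\mathcal{O}_{\sigma,\tau}$ means a complex linear subspace of $\mathcal{T}_n\otimes\mathcal{O}_{\sigma,\tau}$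 that is closed under matrix multiplication and whose elements commute pairwise; it is maximal if it is not properly contained in another commutative subalgebra of $\mathcal{T}_n\otimes\mathcal{O}_{\sigma,\tau}$. For $A,B\in\mathcal{O}_{\sigma,\tau}$ define $$\mathcal{F}_{A,B}=\{\mathbf{T}=(T_{p-q})_{p,q=0}^{n-1}\in\mathcal{T}_n\otimes\mathcal{O}_{\sigma,\tau} : A T_j=B T_{j-n}\text{ for } j=1,\dots,n-1\}.$$ Define (the notation $\mathcal{B}\otimes$ is just a name) $$\mathcal{B}\otimes\mathcal{O}_{\sigma,\tau}=\{\mathbf{T}=(T_{p-q})_{p,q=0}^{n-1}\in\mathcal{T}_n\otimes\mathcal{O}_{\sigma,\tau} : T_j\in\mathcal{R}\text{ for all } j\neq 0\}.$$ *)

(* Defs.v *)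
From mathcomp Require Import all_boot all_order all_algebra.
From mathcomp Require Import boolp classical_sets reals complex.

Set Implicit Arguments.
Unset Strict Implicit.
Unset Printing Implicit Defensive.

Import GRing.Theory.

Local Open Scope ring_scope.
Local Open Scope classical_set_scope.

Section SchurBlockToeplitz.
Variables (C : fieldType) (n sigma tau : nat).

Definition schur_mx (l : C) (X : 'M[C]_(sigma, tau)) : 'M[C]_(sigma + tau) :=
  block_mx l%:M X 0 l%:M.

Definition schur_algebra : set 'M[C]_(sigma + tau) :=
  [set A | exists l X, A = schur_mx l X].

(* All its elements square to 0, so they are nilpotent. *)
Definition schur_radical : set 'M[C]_(sigma + tau) :=
  [set A | exists X, A = schur_mx 0 X].

(* The n x n block matrix (t (p - q))_{p,q}, as a matrix over C of order
   n * (sigma + tau) in the dimension format of \mxblock.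
   Only the values of t at the integers j with -n < j < n matter. *)
Definition block_toeplitz (t : int -> 'M[C]_(sigma + tau)) :
    'M[C]_(\sum_(_ < n) (sigma + tau)) :=
  \mxblock_(p < n, q < n) t (p%:Z - q%:Z).

Definition schur_symbol (t : int -> 'M[C]_(sigma + tau)) : Prop :=
  forall j : int, - n%:Z < j < n%:Z -> schur_algebra (t j).

Definition schur_toeplitz : set 'M[C]_(\sum_(_ < n) (sigma + tau)) :=
  [set T | exists2 t, schur_symbol t & T = block_toeplitz t].

(* Subalgebras are not required to contain the identity matrix. *)
Definition comm_subalgebra
    (M : set 'M[C]_(\sum_(_ < n) (sigma + tau))) : Prop :=
  [/\ M `<=` schur_toeplitz,
      submod_closed (mem M),
      forall S T, M S -> M T -> M (S *m T)
    & forall S T, M S -> M T -> S *m T = T *m S].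

Definition maximal_comm_subalgebra
    (M : set 'M[C]_(\sum_(_ < n) (sigma + tau))) : Prop :=
  comm_subalgebra M /\ forall N, comm_subalgebra N -> ~ (M `<` N).

Definition F_algebra (A B : 'M[C]_(sigma + tau)) :
    set 'M[C]_(\sum_(_ < n) (sigma + tau)) :=
  [set T | exists t, [/\ schur_symbol t, T = block_toeplitz t
     & forall j : int, 0 < j < n%:Z -> A *m t j = B *m t (j - n%:Z)]].

Definition B_algebra : set 'M[C]_(\sum_(_ < n) (sigma + tau)) :=
  [set T | exists t, [/\ schur_symbol t, T = block_toeplitz t
     & forall j : int, - n%:Z < j < n%:Z -> j != 0 -> schur_radical (t j)]].

End SchurBlockToeplitz.

Arguments F_algebra {C} n {sigma tau} A B.
Arguments B_algebra C n sigma tau : clear implicits.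

(* Main.v *)
(** A product of block Toeplitz matrices [(a_(p-q))] and [(b_(p-q))] is again
    block Toeplitz iff [a_p b_(q-n) = a_(p-n) b_q] for all [p, q] in
    [1, ..., n-1].  If a commutative subalgebra contains a matrix with an
    invertible block off the diagonal, which up to a shift by [n] is [a_p] or
    [a_(p-n)] with [0 < p < n], this identity with [p] fixed says that the whole
    subalgebra lies in [F_algebra (a_(p-n)) a_p]; otherwise all off-diagonal
    blocks are in the radical and it lies in [B_algebra].  Both of these are
    commutative subalgebras, and they are maximal: testing the identity against
    the symbol [b_q = B], [b_(q-n) = A] forces membership. *)

Require Import Defs.
From mathcomp Require Import all_boot all_order all_algebra.
From mathcomp Require Import boolp classical_sets reals complex.
From mathcomp Require Import zify.

Set Implicit Arguments.
Unset Strict Implicit.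
Unset Printing Implicit Defensive.

Import Order.TTheory GRing.Theory.

Local Open Scope ring_scope.
Local Open Scope classical_set_scope.

(** * Arithmetic of the Schur algebra and its radical *)

Section SchurAlgebra.
Variables (C : fieldType) (sigma tau : nat).
Local Notation schur_algebra := (@schur_algebra C sigma tau).
Local Notation schur_radical := (@schur_radical C sigma tau).

Lemma schur_mxM (l m : C) (X Y : 'M[C]_(sigma, tau)) :
  schur_mx l X *m schur_mx m Y = schur_mx (l * m) (l *: Y + m *: X).
Proof.
by rewrite /schur_mx mulmx_block !mul0mx !mulmx0 !addr0 !add0r -!scalar_mxM
  mul_scalar_mx mul_mx_scalar.
Qed.

Lemma schur_mx_lin (c l m : C) (X Y : 'M[C]_(sigma, tau)) :
  c *: schur_mx l X + schur_mx m Y = schur_mx (c * l + m) (c *: X + Y).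
Proof.
by rewrite /schur_mx scale_block_mx add_block_mx scaler0 addr0 !scale_scalar_mx
  -!raddfD.
Qed.

Lemma schur_mx0 : schur_mx 0 (0 : 'M[C]_(sigma, tau)) = 0.
Proof. by rewrite /schur_mx !raddf0 block_mx0. Qed.

Lemma schur_radical_sub A : schur_radical A -> schur_algebra A.
Proof. by case=> X ->; exists 0, X. Qed.

Lemma schur_algebra_lin (c : C) A B :
  schur_algebra A -> schur_algebra B -> schur_algebra (c *: A + B).
Proof.
by move=> [l [X ->]] [m [Y ->]]; rewrite schur_mx_lin; do 2 eexists.
Qed.

Lemma schur_radical_lin (c : C) A B :
  schur_radical A -> schur_radical B -> schur_radical (c *: A + B).
Proof.
by move=> [X ->] [Y ->]; rewrite schur_mx_lin mulr0 addr0; eexists.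
Qed.

Lemma schur_radical0 : schur_radical 0.
Proof. by exists 0; rewrite schur_mx0. Qed.

Lemma schur_algebra_sum n (F : 'I_n -> 'M[C]_(sigma + tau)) :
  (forall i, schur_algebra (F i)) -> schur_algebra (\sum_i F i).
Proof.
move=> sF; apply: (big_ind schur_algebra) => //.
  exact: schur_radical_sub schur_radical0.
by move=> A B sA sB; rewrite -[A]scale1r; apply: schur_algebra_lin.
Qed.

Lemma schur_radical_sum n (F : 'I_n -> 'M[C]_(sigma + tau)) :
  (forall i, schur_radical (F i)) -> schur_radical (\sum_i F i).
Proof.
move=> sF; apply: (big_ind schur_radical) => //; first exact: schur_radical0.
by move=> A B sA sB; rewrite -[A]scale1r; apply: schur_radical_lin.
Qed.

Lemma schur_algebraM A B :
  schur_algebra A -> schur_algebra B -> schur_algebra (A *m B).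
Proof. by move=> [l [X ->]] [m [Y ->]]; rewrite schur_mxM; do 2 eexists. Qed.

Lemma schur_algebraC A B :
  schur_algebra A -> schur_algebra B -> A *m B = B *m A.
Proof.
by move=> [l [X ->]] [m [Y ->]]; rewrite !schur_mxM mulrC addrC.
Qed.

Lemma schur_radicalMr A B :
  schur_algebra A -> schur_radical B -> schur_radical (A *m B).
Proof.
by move=> [l [X ->]] [Y ->]; rewrite schur_mxM mulr0; eexists.
Qed.

Lemma schur_radicalMl A B :
  schur_radical A -> schur_algebra B -> schur_radical (A *m B).
Proof.
by move=> [X ->] [m [Y ->]]; rewrite schur_mxM mul0r; eexists.
Qed.

Lemma schur_radical_mul0 A B :
  schur_radical A -> schur_radical B -> A *m B = 0.
Proof.
by move=> [X ->] [Y ->]; rewrite schur_mxM mulr0 !scale0r addr0 schur_mx0.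
Qed.

(** The algebra is local: outside the radical the diagonal scalar is nonzero, and the matrix is
    upper triangular with that scalar along its diagonal. *)
Lemma schur_algebra_unit A :
  schur_algebra A -> ~ schur_radical A -> A \in unitmx.
Proof.
move=> [l [X ->]] nrad; have l0 : l != 0.
  by apply/eqP => l0; apply: nrad; exists X; rewrite l0.
by rewrite unitmxE /schur_mx det_ublock !det_scalar unitrM !unitrX // unitfE.
Qed.

Lemma schur_mx_eq0 l (X : 'M[C]_(sigma, tau)) : schur_mx l X = 0 -> X = 0.
Proof. by rewrite -[RHS]block_mx0 => /eq_block_mx[]. Qed.

(** [A] acts on the radical through its diagonal scalar, so annihilating a single nonzero radical
    element already forces that scalar to vanish. This is the test behind the maximality of
    [B_algebra]. *)
Lemma schur_algebraM_eq0 A B : schur_algebra A ->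
  schur_radical B -> B != 0 -> A *m B = 0 -> schur_radical A.
Proof.
move=> [l [X ->]] [Y ->] Y0; rewrite schur_mxM => /schur_mx_eq0.
rewrite scale0r addr0 => /eqP; rewrite scaler_eq0 => /orP[/eqP ->|/eqP eY].
  by exists X.
by rewrite eY schur_mx0 eqxx in Y0.
Qed.

Lemma schur_radical_nonzero : (0 < sigma)%N -> (0 < tau)%N ->
  exists2 A, schur_radical A & A != 0.
Proof.
move=> s0 t0; exists (schur_mx 0 (const_mx 1)); first by eexists.
apply/eqP => /schur_mx_eq0/matrixP/(_ (Ordinal s0) (Ordinal t0)).
by rewrite !mxE => /eqP; rewrite oner_eq0.
Qed.

Lemma schur_radicalM A B : schur_radical A -> schur_algebra B ->
  exists2 l, A *m B = l *: A & l = 0 -> schur_radical B.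
Proof.
move=> [X ->] [l [Y ->]]; exists l; last by move=> ->; exists Y.
by rewrite schur_mxM -[RHS]addr0 -schur_mx0 schur_mx_lin scale0r add0r mul0r
  mulr0 !addr0.
Qed.

End SchurAlgebra.

Lemma free_pair_eq0 (K : fieldType) (V : vectType K) (u v : V) (k l : K) :
  free [:: u; v] -> k *: u = l *: v -> k = 0 /\ l = 0.
Proof.
rewrite free_cons seq1_free span_seq1 => /andP[uv v0] e.
have [k0|k0] := eqVneq k 0.
  split=> //; apply/eqP; move/eqP: e.
  by rewrite k0 scale0r eq_sym scaler_eq0 (negPf v0) orbF.
case/negP: uv; apply/vlineP; exists (k^-1 * l).
by rewrite -scalerA -e scalerA mulVf // scale1r.
Qed.

(** * Products of block Toeplitz matrices *)

Section BlockToeplitz.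
Variables (C : fieldType) (n sigma tau : nat).
Local Notation symbol := (int -> 'M[C]_(sigma + tau)).
Local Notation bt := (@block_toeplitz C n sigma tau).
Implicit Types a b c : symbol.

Lemma block_toeplitz_lin (k : C) a b :
  k *: bt a + bt b = bt (fun j => k *: a j + b j).
Proof. by apply/matrixP => i j; rewrite !mxE. Qed.

Lemma block_toeplitz0 : bt (fun=> 0) = 0.
Proof. by apply/matrixP => i j; rewrite !mxE. Qed.

Lemma block_toeplitzM a b :
  bt a *m bt b =
    \mxblock_(p < n, q < n) \sum_(k < n) a (p%:Z - k%:Z) *m b (k%:Z - q%:Z).
Proof. exact: mul_mxblock. Qed.

(** One step down a diagonal of the product shifts the summation index by one, so the two sums
    differ only in one boundary term each. The index [-q.+1] is written [(n - q.+1) - n] to exhibit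
    the shift by [n] of the compatibility identity. *)
Lemma conv_shift a b (p q : nat) : (p.+1 < n)%N -> (q.+1 < n)%N ->
  \sum_(k < n) a (p.+1%:Z - k%:Z) *m b (k%:Z - q.+1%:Z)
    + a (p.+1%:Z - n%:Z) *m b (n%:Z - q.+1%:Z) =
  \sum_(k < n) a (p%:Z - k%:Z) *m b (k%:Z - q%:Z)
    + a p.+1%:Z *m b ((n%:Z - q.+1%:Z) - n%:Z).
Proof.
case: n => // m pm qm.
rewrite big_ord_recl [X in _ = X + _]big_ord_recr /=.
rewrite [LHS]addrAC [LHS]addrC -!addrA; congr (_ + _).
  by apply: eq_bigr => k _; congr (a _ *m b _); rewrite /= /bump /=; lia.
by rewrite addrC; congr (a _ *m b _ + a _ *m b _); lia.
Qed.

Lemma toeplitz_mul_compat a b c : bt a *m bt b = bt c ->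
  forall p q : int, 0 < p < n%:Z -> 0 < q < n%:Z ->
  a p *m b (q - n%:Z) = a (p - n%:Z) *m b q.
Proof.
rewrite block_toeplitzM /block_toeplitz => /eq_mxblockP eabc p q pn qn.
have p1 : (`|p|.-1.+1 < n)%N by lia.
(* The boundary terms evaluate [b] at [n] minus the column, so the blocks to compare are those at
   row [p], column [n - q], and their predecessors on the diagonal. *)
have q1 : ((n - `|q|).-1.+1 < n)%N by lia.
have := conv_shift a b p1 q1.
have := eabc (Ordinal p1) (Ordinal q1); rewrite /= => ->.
have := eabc (Ordinal (ltnW p1)) (Ordinal (ltnW q1)); rewrite /= => ->.
set j := (_ - _ in X in X + _ = _); set j' := (_ - _ in X in _ = X + _).
have -> : j = j' by rewrite /j /j'; lia.
move/addrI => /esym.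
have -> : `|p|.-1.+1%:Z = p by lia.
by have -> : n%:Z - (n - `|q|).-1.+1%:Z = q by lia.
Qed.

(* The block at [(j, 0)] of the product if [j >= 0], at [(0, -j)] if [j <= 0]. *)
Definition toeplitz_conv a b : symbol := fun j =>
  \sum_(k < n) a (Num.max j 0 - k%:Z) *m b (k%:Z + Num.min j 0).

Lemma toeplitz_mul_conv a b :
  (forall p q : int, 0 < p < n%:Z -> 0 < q < n%:Z ->
     a p *m b (q - n%:Z) = a (p - n%:Z) *m b q) ->
  bt a *m bt b = bt (toeplitz_conv a b).
Proof.
move=> compat; rewrite block_toeplitzM; apply: eq_mxblock => -[p pn] [q qn] /=.
(* Climb each diagonal to the first row or column, where [toeplitz_conv] is read off; on the way the
   boundary terms of [conv_shift] cancel by [compat]. *)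
elim: p q pn qn => [|p IHp] [|q] pn qn.
- by apply: eq_bigr => k _; congr (a _ *m b _); lia.
- by apply: eq_bigr => k _; congr (a _ *m b _); lia.
- by apply: eq_bigr => k _; congr (a _ *m b _); lia.
- have -> : p.+1%:Z - q.+1%:Z = p%:Z - q%:Z by lia.
  rewrite -IHp; [|by lia..].
  have := conv_shift a b pn qn.
  by rewrite compat; [move/addIr|lia..].
Qed.

(* Conjugation by the block flip [k |-> n-1-k] turns a block Toeplitz matrix
   into its blockwise transpose, which reverses products of commuting blocks. *)
Lemma toeplitz_mulC a b c : schur_symbol n a -> schur_symbol n b ->
  bt b *m bt a = bt c -> bt a *m bt b = bt b *m bt a.
Proof.
move=> sa sb ec; rewrite ec; move: ec; rewrite !block_toeplitzM /block_toeplitz.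
move=> /eq_mxblockP ec; apply: eq_mxblock => p q.
have -> : p%:Z - q%:Z = (rev_ord q)%:Z - (rev_ord p)%:Z.
  by case: p q => p pn [q qn] /=; lia.
rewrite -ec (reindex_inj rev_ord_inj) /=.
apply: eq_bigr => -[k kn] _; case: p q => p pn [q qn] /=.
rewrite (@schur_algebraC _ _ _ (a _)); [|by apply: sa; lia|by apply: sb; lia].
by congr (b _ *m a _); lia.
Qed.

Lemma schur_symbol_conv a b : schur_symbol n a -> schur_symbol n b ->
  schur_symbol n (toeplitz_conv a b).
Proof.
move=> sa sb j jn; apply: schur_algebra_sum => -[k kn] /=.
by apply: schur_algebraM; [apply: sa|apply: sb]; lia.
Qed.

(** * Criteria for commutative subalgebras and for maximality *)

Lemma comm_subalgebra_of_mul_closed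
    (M : set 'M[C]_(\sum_(i < n) (sigma + tau))) :
  M `<=` @schur_toeplitz C n sigma tau -> submod_closed (mem M) ->
  (forall S T, M S -> M T -> M (S *m T)) ->
  comm_subalgebra M.
Proof.
move=> sM linM mulM; split=> // S T MS MT.
(* Commutativity follows from closure: [T *m S] lies in [M], hence is block Toeplitz, and then
   [toeplitz_mulC] applies. *)
have [c _ ec] := sM _ (mulM _ _ MT MS).
have [[a sa ea] [b sb eb]] := (sM _ MS, sM _ MT); rewrite ea eb in ec *.
exact: toeplitz_mulC ec.
Qed.

Lemma comm_subalgebra_compat (M : set 'M[C]_(\sum_(i < n) (sigma + tau))) a b :
  comm_subalgebra M -> M (bt a) -> M (bt b) ->
  forall p q : int, 0 < p < n%:Z -> 0 < q < n%:Z ->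
  a p *m b (q - n%:Z) = a (p - n%:Z) *m b q.
Proof.
case=> sM _ mulM _ Ma Mb; have [c _ ec] := sM _ (mulM _ _ Ma Mb).
exact: toeplitz_mul_compat ec.
Qed.

Lemma maximal_comm_subalgebra_eq
    (M N : set 'M[C]_(\sum_(i < n) (sigma + tau))) :
  maximal_comm_subalgebra M -> comm_subalgebra N -> M `<=` N -> M = N.
Proof.
case=> _ maxM cN MN; apply/seteqP; split=> //.
by apply: contrapT => nNM; apply: (maxM N).
Qed.

Lemma maximal_comm_subalgebraI
    (M : set 'M[C]_(\sum_(i < n) (sigma + tau))) :
  comm_subalgebra M ->
  (forall N, comm_subalgebra N -> M `<=` N -> N `<=` M) ->
  maximal_comm_subalgebra M.
Proof. by move=> cM maxM; split=> // N cN [MN]; apply; apply: maxM. Qed.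

(** Common frame for [F_algebra] and [B_algebra]: compatibility makes the product block Toeplitz
    with symbol [toeplitz_conv a b], so closure is a question about symbols only. *)
Lemma comm_subalgebra_symbol (P : symbol -> Prop) :
  P (fun=> 0) ->
  (forall (k : C) a b, P a -> P b -> P (fun j => k *: a j + b j)) ->
  (forall a b, schur_symbol n a -> schur_symbol n b -> P a -> P b ->
     (forall p q : int, 0 < p < n%:Z -> 0 < q < n%:Z ->
        a p *m b (q - n%:Z) = a (p - n%:Z) *m b q)
     /\ P (toeplitz_conv a b)) ->
  comm_subalgebra [set T | exists t, [/\ schur_symbol n t, T = bt t & P t]].
Proof.
move=> P0 Plin Pmul; apply: comm_subalgebra_of_mul_closed.
- by move=> T [t [st -> _]]; exists t.
- split.
    apply/mem_set; exists (fun=> 0); rewrite block_toeplitz0; split=> // j _.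
    exact: schur_radical_sub (schur_radical0 _ _ _).
  move=> k S T /set_mem [a [sa -> Pa]] /set_mem [b [sb -> Pb]]; apply/mem_set.
  exists (fun j => k *: a j + b j); rewrite block_toeplitz_lin.
  split=> [j jn||]; [|by []|exact: Plin].
  exact: schur_algebra_lin (sa _ jn) (sb _ jn).
- move=> S T [a [sa -> Pa]] [b [sb -> Pb]].
  have [compat Pab] := Pmul a b sa sb Pa Pb.
  exists (toeplitz_conv a b); split=> //; first exact: schur_symbol_conv.
  exact: toeplitz_mul_conv.
Qed.

(** * Test matrices supported on two diagonals, and the algebras [F_algebra] *)

Definition two_point_symbol (q : int) (A B : 'M[C]_(sigma + tau)) : symbol :=
  fun j => if j == q then B else if j == q - n%:Z then A else 0.

Lemma two_point_symbolE q (A B : 'M[C]_(sigma + tau)) : 0 < q < n%:Z ->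
  two_point_symbol q A B q = B /\ two_point_symbol q A B (q - n%:Z) = A.
Proof.
move=> qn; rewrite /two_point_symbol !eqxx; split=> //.
by have -> : (q - n%:Z == q) = false by lia.
Qed.

Lemma schur_two_point q (A B : 'M[C]_(sigma + tau)) :
  schur_algebra A -> schur_algebra B ->
  schur_symbol n (two_point_symbol q A B).
Proof.
move=> sA sB j _; rewrite /two_point_symbol; do 2 case: eqP => // _.
exact: schur_radical_sub (schur_radical0 _ _ _).
Qed.

(** At [q] the defining condition reads [A *m B = B *m A]; at every other index both sides
    vanish. *)
Lemma F_algebra_two_point q (A B : 'M[C]_(sigma + tau)) : 0 < q < n%:Z ->
  schur_algebra A -> schur_algebra B ->
  F_algebra n A B (bt (two_point_symbol q A B)).
Proof.
move=> qn sA sB; exists (two_point_symbol q A B).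
split=> //; first exact: schur_two_point.
move=> j jn; have [->|jq] := eqVneq j q.
  have [-> ->] := two_point_symbolE A B qn; exact: schur_algebraC.
rewrite /two_point_symbol (negPf jq).
have -> : (j == q - n%:Z) = false by lia.
have -> : (j - n%:Z == q) = false by lia.
have -> : (j - n%:Z == q - n%:Z) = false by lia.
by rewrite !mulmx0.
Qed.

(** In the sum for index [j], the terms with [k < j] are carried to index [j - n] by the condition
    on [a], those with [k >= j] by the condition on [b]. *)
Lemma F_algebra_conv (A B : 'M[C]_(sigma + tau)) a b :
  schur_algebra A -> schur_algebra B -> schur_symbol n a -> schur_symbol n b ->
  (forall j : int, 0 < j < n%:Z -> A *m a j = B *m a (j - n%:Z)) ->
  (forall j : int, 0 < j < n%:Z -> A *m b j = B *m b (j - n%:Z)) ->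
  forall j : int, 0 < j < n%:Z ->
    A *m toeplitz_conv a b j = B *m toeplitz_conv a b (j - n%:Z).
Proof.
move=> sA sB sa sb Fa Fb j jn; rewrite /toeplitz_conv !mulmx_sumr.
have -> : Num.max j 0 = j by lia.
have -> : Num.min j 0 = 0 by lia.
have -> : Num.max (j - n%:Z) 0 = 0 by lia.
have -> : Num.min (j - n%:Z) 0 = j - n%:Z by lia.
have [J ej] : exists J : nat, j = J%:Z by exists `|j|%N; lia.
subst j; have Jn : (J <= n)%N by lia.
rewrite -(big_mkord xpredT
    (fun k : nat => A *m (a (J%:Z - k%:Z) *m b (k%:Z + 0)))).
rewrite -(big_mkord xpredT
    (fun k : nat => B *m (a (0 - k%:Z) *m b (k%:Z + (J%:Z - n%:Z))))).
(* Cut the left sum at [J] and the right one at [n - J]: the pieces then match crosswise, whence the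
   swap. *)
rewrite (@big_cat_nat _ _ _ J) //= addrC.
rewrite [RHS](@big_cat_nat _ _ _ (n - J)) ?leq_subr //=.
rewrite -{1}[J]add0n big_addn -{3}[(n - J)%N]add0n big_addn.
have -> : (n - (n - J))%N = J by lia.
congr (_ + _); rewrite !big_mkord; apply: eq_bigr => -[k kn] _ /=.
  have -> : J%:Z - (k + J)%N%:Z = 0 - k%:Z by lia.
  have -> : (k + J)%N%:Z + 0 = k%:Z + J%:Z by lia.
  rewrite !mulmxA.
  rewrite (schur_algebraC sA (B := a _)); last by apply: sa; lia.
  rewrite (schur_algebraC sB (B := a _)); last by apply: sa; lia.
  by rewrite -!mulmxA Fb ?addrA //; lia.
rewrite !mulmxA Fa; last by lia.
by congr (_ *m a _ *m b _); lia.
Qed.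

Lemma comm_subalgebra_F (A B : 'M[C]_(sigma + tau)) :
  schur_algebra A -> schur_algebra B ->
  (A \in unitmx) || (B \in unitmx) ->
  @comm_subalgebra C n sigma tau (F_algebra n A B).
Proof.
move=> sA sB AB; apply: comm_subalgebra_symbol.
- by move=> j _; rewrite !mulmx0.
- move=> k a b Fa Fb j jn.
  by rewrite !mulmxDr -!scalemxAr Fa // Fb.
- move=> a b sa sb Fa Fb; split; last exact: F_algebra_conv.
  move=> p q pn qn.
  have [sap sapn] : schur_algebra (a p) /\ schur_algebra (a (p - n%:Z)).
    by split; apply: sa; lia.
  (* Multiply by the invertible one of the two: with [A] both sides become [B a_(p-n) b_(q-n)], with
     [B] both become [A a_p b_q]. *)
  case/orP: AB => uAB; apply: (can_inj (mulKmx uAB)) => /=; rewrite !mulmxA.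
    by rewrite Fa // (schur_algebraC sA sapn) (schur_algebraC sB sapn)
      -!mulmxA Fb.
  by rewrite -Fa // (schur_algebraC sA sap) (schur_algebraC sB sap)
    -!mulmxA Fb.
Qed.

Lemma maximal_comm_subalgebra_F (A B : 'M[C]_(sigma + tau)) :
  schur_algebra A -> schur_algebra B ->
  (A \in unitmx) || (B \in unitmx) ->
  @maximal_comm_subalgebra C n sigma tau (F_algebra n A B).
Proof.
move=> sA sB AB; apply: maximal_comm_subalgebraI.
  exact: comm_subalgebra_F.
move=> N cN FN T NT; have [sN _ _ _] := cN.
have [a sa eT] := sN _ NT; rewrite eT in NT *; exists a; split=> // p pn.
(* Against the test matrix, with both indices equal to [p], compatibility reads
   [a_p A = a_(p-n) B]. *)
have := comm_subalgebra_compat cN NT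
  (FN _ (F_algebra_two_point pn sA sB)) pn pn.
have [-> ->] := two_point_symbolE A B pn.
have [sap sapn] : schur_algebra (a p) /\ schur_algebra (a (p - n%:Z)).
  by split; apply: sa; lia.
by rewrite (schur_algebraC sap sA) (schur_algebraC sapn sB).
Qed.

(** * The algebra [B_algebra] *)

Lemma comm_subalgebra_B :
  @comm_subalgebra C n sigma tau (B_algebra C n sigma tau).
Proof.
apply: comm_subalgebra_symbol.
- by move=> j _ _; exact: schur_radical0.
- move=> k a b Ba Bb j jn j0.
  exact: schur_radical_lin (Ba _ jn j0) (Bb _ jn j0).
move=> a b sa sb Ba Bb; split.
  by move=> p q pn qn; rewrite !schur_radical_mul0 //;
    by [apply: Ba; lia | apply: Bb; lia].
move=> j jn j0; apply: schur_radical_sum => -[k kn] /=.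
(* The indices of the two factors add up to [j], which is nonzero, so at least one factor is off the
   diagonal and hence radical. *)
have [e|ne] := eqVneq (Num.max j 0 - k%:Z) 0.
  by apply: schur_radicalMr; [apply: sa|apply: Bb]; lia.
by apply: schur_radicalMl; [apply: Ba|apply: sb]; lia.
Qed.

(** On radical [A] and [B] the condition equates multiples of [A] and [B] by the diagonal scalars of
    [t j] and [t (j - n)]; independence makes both scalars zero. Conversely, products of radical
    elements vanish. *)
Lemma F_algebra_radical (A B : 'M[C]_(sigma + tau)) :
  schur_radical A -> schur_radical B -> free [:: A; B] ->
  F_algebra n A B = B_algebra C n sigma tau.
Proof.
move=> rA rB AB; apply/seteqP; split=> T [t [st -> ht]]; exists t; split=> //.
  have rad (j : int) : 0 < j < n%:Z ->
      schur_radical (t j) /\ schur_radical (t (j - n%:Z)).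
    move=> jn; have [stj stjn] : schur_algebra (t j) /\
      schur_algebra (t (j - n%:Z)) by split; apply: st; lia.
    have [l eA rl] := schur_radicalM rA stj.
    have [m eB rm] := schur_radicalM rB stjn.
    by have := ht _ jn; rewrite eA eB => /(free_pair_eq0 AB) [/rl ? /rm].
  move=> j jn j0; have [jp|jm] := ltP 0 j; first by apply: (rad j _).1; lia.
  by rewrite -(addrK n%:Z j); apply: (rad _ _).2; lia.
by move=> j jn; rewrite !schur_radical_mul0 //; apply: ht; lia.
Qed.

Lemma maximal_comm_subalgebra_B : (0 < sigma)%N -> (0 < tau)%N ->
  @maximal_comm_subalgebra C n sigma tau (B_algebra C n sigma tau).
Proof.
move=> s0 t0; apply: maximal_comm_subalgebraI; first exact: comm_subalgebra_B.
move=> N cN BN T NT; have [sN _ _ _] := cN.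
have [a sa eT] := sN _ NT; rewrite eT in NT *; exists a; split=> //.
have [X rX X0] := schur_radical_nonzero C s0 t0.
have r0 := schur_radical0 C sigma tau.
have N2 q A B : schur_radical A -> schur_radical B ->
    N (bt (two_point_symbol q A B)).
  move=> rA rB; apply: BN; exists (two_point_symbol q A B); split=> //.
    by apply: schur_two_point; apply: schur_radical_sub.
  by move=> j _ _; rewrite /two_point_symbol; do 2 case: eqP => // _.
move=> j jn j0; apply: (schur_algebraM_eq0 (sa _ jn) rX X0).
(* Placing [X] on one test diagonal and 0 on the other isolates [a j *m X = 0]; the sign of [j]
   decides which diagonal carries [X]. *)
have [jp|jm] := ltP 0 j.
  have jn' : 0 < j < n%:Z by lia.
  have := comm_subalgebra_compat cN NT (N2 j _ _ rX r0) jn' jn'.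
  by have [-> ->] := two_point_symbolE X 0 jn'; rewrite mulmx0.
have jn' : 0 < j + n%:Z < n%:Z by lia.
have := comm_subalgebra_compat cN NT (N2 (j + n%:Z) _ _ r0 rX) jn' jn'.
by have [-> ->] := two_point_symbolE 0 X jn'; rewrite mulmx0 addrK => <-.
Qed.

(** * Dichotomy for commutative subalgebras *)

Lemma comm_subalgebra_sub (M : set 'M[C]_(\sum_(i < n) (sigma + tau))) :
  @comm_subalgebra C n sigma tau M ->
  (exists A B : 'M[C]_(sigma + tau), [/\ schur_algebra A, schur_algebra B,
     (A \in unitmx) || (B \in unitmx) & M `<=` F_algebra n A B])
  \/ M `<=` B_algebra C n sigma tau.
Proof.
move=> cM; have [sM _ _ _] := cM.
have [radM|] := pselect (forall a, schur_symbol n a -> M (bt a) ->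
  forall j : int, - n%:Z < j < n%:Z -> j != 0 -> schur_radical (a j)).
  right=> T MT; have [a sa eT] := sM _ MT; rewrite eT in MT *.
  by exists a; split=> //; apply: radM.
move=> /existsNP [a /not_implyP [sa /not_implyP [Ma]]].
move=> /existsNP [j /not_implyP [jn /not_implyP [j0 nrad]]]; left.
have uaj := schur_algebra_unit (sa _ jn) nrad.
have [p pn ja] : exists2 p : int, 0 < p < n%:Z & j = p \/ j = p - n%:Z.
  have [jp|jm] := ltP 0 j; first by exists j; [lia|left].
  by exists (j + n%:Z); [lia|right; lia].
exists (a (p - n%:Z)), (a p).
split; [by apply: sa; lia|by apply: sa; lia| |].
  by case: ja uaj => -> ->; rewrite ?orbT.
move=> T MT; have [b sb eT] := sM _ MT; rewrite eT in MT *.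
by exists b; split=> // q qn; rewrite -(comm_subalgebra_compat cM Ma MT).
Qed.

End BlockToeplitz.

Theorem theorem4p1 (R : realType) (n sigma tau : nat)
    (hn : (0 < n)%N) (hsigma : (0 < sigma)%N) (htau : (0 < tau)%N)
    (hst : (`|sigma - tau| <= 1)%N) :
  [/\ forall M : set 'M[R[i]]_(\sum_(_ < n) (sigma + tau)),
        maximal_comm_subalgebra M ->
        (exists A B : 'M[R[i]]_(sigma + tau),
           [/\ schur_algebra A, schur_algebra B,
               (A \in unitmx) || (B \in unitmx) & M = F_algebra n A B])
        \/ M = B_algebra R[i] n sigma tau,
      forall A B : 'M[R[i]]_(sigma + tau),
        schur_radical A -> schur_radical B -> free [:: A; B] ->
        F_algebra n A B = B_algebra R[i] n sigma tau,
      forall A B : 'M[R[i]]_(sigma + tau),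
        schur_algebra A -> schur_algebra B ->
        (A \in unitmx) || (B \in unitmx) ->
        maximal_comm_subalgebra (F_algebra n A B)
    & maximal_comm_subalgebra (B_algebra R[i] n sigma tau)].
Proof.
split=> [M maxM|A B|A B|].
- have [cM _] := maxM.
  (* The enclosing algebra is itself a commutative subalgebra, so maximality of [M] turns the
     inclusion into equality. *)
  have [[A [B [sA sB AB MF]]]|MB] := comm_subalgebra_sub cM.
    left; exists A, B; split=> //; apply: maximal_comm_subalgebra_eq => //.
    exact: comm_subalgebra_F.
  right; apply: maximal_comm_subalgebra_eq => //; exact: comm_subalgebra_B.
- exact: F_algebra_radical.
- exact: maximal_comm_subalgebra_F.
- exact: maximal_comm_subalgebra_B.
Qed.
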